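(* Let $\theta, a:\mathbb{R}\to\mathbb{R}$ be $C^\infty$ functions and let $\mathcal{L}=\{L_{(\theta(t),a(t))}\}_{t\in\mathbb{R}}$ be the associated straight line family in the plane $\mathbb{R}^2$. Suppose that the Gauss mapping $\nu:\mathbb{R}\to S^1$ of $\mathcal{L}$ is non-singular. Then $\mathcal{L}$ is creative, and therefore $\mathcal{L}$ creates an envelope (that is, there exists an envelope created by $\mathcal{L}$).
   Context: For $C^\infty$ functions $\theta,a:\mathbb{R}\to\mathbb{R}$, the straight line family $\mathcal{L}=\{L_{(\theta(t),a(t))}\}_{t\in\mathbb{R}}$ consists of the lines $L_{(\theta(t),a(t))}=\{(X,Y)\in\mathbb{R}^2 \mid X\cos\theta(t)+Y\sin\theta(t)=a(t)\}$. Its Gauss mapping is $\nu:\mathbb{R}\to S^1$, $\nu(t)=(\cos\theta(t),\sin\theta(t))$. A point $t$ is a regular point of $\nu$ if $\frac{d\nu}{dt}(t)\neq 0$ (equivalently $\frac{d\theta}{dt}(t)\ne 0$), and a singular point otherwise; $\nu$ is non-singular if every $t\in\mathbb{R}$ is a regular point. The family $\mathcal{L}$ is creative if there exists a $C^\infty$ function $b:\mathbb{R}\to\mathbb{R}$ (called a creator) such that $\frac{da}{dt}(t)=b(t)\frac{d\theta}{dt}(t)$ for all $t\in\mathbb{R}$. An envelope created by $\mathcal{L}$ is a $C^\infty$ mapping $f:\mathbb{R}\to\mathbb{R}^2$ such that for every $t\in\mathbb{R}$: (a) $\frac{df}{dt}(t)\cdot\nu(t)=0$ (standard scalar product), and (b)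 $f(t)\in L_{(\theta(t),a(t))}$. *)

(* Defs.v *)
From Stdlib Require Import Reals.
From Coquelicot Require Import Coquelicot.
Open Scope R_scope.

Definition smooth (f : R -> R) : Prop :=
  forall (n : nat) (t : R), ex_derive_n f n t.

Definition plane : Type := (R * R)%type.

Definition dot (u v : plane) : R := fst u * fst v + snd u * snd v.

(* Smoothness and derivative of a plane curve are taken coordinatewise.
   [Derive] is total, so [curve_deriv] is meaningful only where both
   coordinates are differentiable. *)
Definition smooth_curve (f : R -> plane) : Prop :=
  smooth (fun t => fst (f t)) /\ smooth (fun t => snd (f t)).

Definition curve_deriv (f : R -> plane) (t : R) : plane :=
  (Derive (fun s => fst (f s)) t, Derive (fun s => snd (f s)) t).

Definition line (theta a : R) (p : plane) : Prop :=
  fst p * cos theta + snd p * sin theta = a.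

Definition line_family (theta a : R -> R) (t : R) : plane -> Prop :=
  line (theta t) (a t).

Definition gauss (theta : R -> R) (t : R) : plane :=
  (cos (theta t), sin (theta t)).

Lemma gauss_unit (theta : R -> R) (t : R) :
  dot (gauss theta t) (gauss theta t) = 1.
Proof. unfold dot, gauss; simpl. rewrite Rplus_comm. apply sin2_cos2. Qed.

Definition regular_point (nu : R -> plane) (t : R) : Prop :=
  curve_deriv nu t <> (0, 0).

Definition non_singular (nu : R -> plane) : Prop :=
  forall t : R, regular_point nu t.

Definition is_creator (theta a b : R -> R) : Prop :=
  smooth b /\ forall t : R, Derive a t = b t * Derive theta t.

Definition creative (theta a : R -> R) : Prop :=
  exists b : R -> R, is_creator theta a b.

Definition is_envelope (theta a : R -> R) (f : R -> plane) : Prop :=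
  smooth_curve f /\
  forall t : R,
    dot (curve_deriv f t) (gauss theta t) = 0 /\ line_family theta a t (f t).

(* Main.v *)
Require Import Defs.
From Stdlib Require Import Reals Lia.
From Coquelicot Require Import Coquelicot.
Open Scope R_scope.

(** Differentiating [(cos theta, sin theta)] gives [theta' * (- sin theta, cos theta)],
    so the Gauss map is non-singular exactly when [theta'] never vanishes, and the only
    possible creator is the quotient [b = a' / theta'].  Write [nu = (cos theta, sin theta)]
    and [mu = (- sin theta, cos theta)], so that [nu' = theta' mu] and [mu' = - theta' nu].
    The lines demand [f . nu = a], and differentiating this with [f' . nu = 0] forces
    [f . mu = b]; hence [f = a nu + b mu], that is
    [f = (a cos theta - b sin theta, a sin theta + b cos theta)].
    Conversely, [f' . nu = a' - b theta' = 0] for this [f] ([envelope_of_creator]), so every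
    creator yields an envelope.

    What remains is that [b] and [f] are smooth.  The smooth functions are closed under
    sums, opposites, products, inverses of nowhere vanishing functions, and composition
    with cosine and sine; each closure is an induction on the order of differentiability,
    since the derivative of the new function is built by the same operations from
    functions of one order less. *)

(** An explicit derivative [g], instead of [Derive f], makes this property stable under
    pointwise equality of derivatives, so the inductions below need no extensionality. *)
Fixpoint times_differentiable (n : nat) (f : R -> R) : Prop :=
  match n with
  | O => True
  | S m => exists g : R -> R,
      (forall t, is_derive f t (g t)) /\ times_differentiable m g
  end.

Lemma smooth_derivative (f : R -> R) : smooth f -> smooth (Derive f).
Proof.
  intros Hf [|n] t; [exact I|].
  apply (ex_derive_ext (Derive_n f (S n))); [|exact (Hf (S (S n)) t)].
  intro s; replace (S n) with (n + 1)%nat by lia.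
  symmetry; exact (Derive_n_comp f n 1 s).
Qed.

Lemma smooth_times_differentiable (f : R -> R) (n : nat) :
  smooth f -> times_differentiable n f.
Proof.
  revert f; induction n as [|n IH]; intros f Hf; [exact I|].
  exists (Derive f); split.
  - intro t; apply Derive_correct; exact (Hf 1%nat t).
  - apply IH, smooth_derivative, Hf.
Qed.

Lemma times_differentiable_smooth (f : R -> R) :
  (forall n, times_differentiable n f) -> smooth f.
Proof.
  intros Hf n; generalize (Hf n); clear Hf; revert f.
  induction n as [|n IH]; intros f Hf t; [exact I|].
  destruct Hf as [g [Hg Dg]].
  destruct n as [|n]; [exists (g t); exact (Hg t)|].
  apply (ex_derive_ext (Derive_n g n)); [|exact (IH g Dg t)].
  intro s; replace (S n) with (n + 1)%nat by lia.
  rewrite <- (Derive_n_comp f n 1 s).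
  apply Derive_n_ext; intro u; symmetry; apply is_derive_unique, Hg.
Qed.

Lemma times_differentiable_pred (n : nat) (f : R -> R) :
  times_differentiable (S n) f -> times_differentiable n f.
Proof.
  revert f; induction n as [|n IH]; intros f Hf; [exact I|].
  destruct Hf as [g [Hg Dg]]; exists g; auto.
Qed.

Lemma times_differentiable_plus (n : nat) (f g : R -> R) :
  times_differentiable n f -> times_differentiable n g ->
  times_differentiable n (fun t => f t + g t).
Proof.
  revert f g; induction n as [|n IH]; intros f g Hf Hg; [exact I|].
  destruct Hf as [f' [Hf Df]], Hg as [g' [Hg Dg]].
  exists (fun t => f' t + g' t); split; [|auto].
  intro t; exact (is_derive_plus f g t (f' t) (g' t) (Hf t) (Hg t)).
Qed.

Lemma times_differentiable_opp (n : nat) (f : R -> R) :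
  times_differentiable n f -> times_differentiable n (fun t => - f t).
Proof.
  revert f; induction n as [|n IH]; intros f Hf; [exact I|].
  destruct Hf as [f' [Hf Df]].
  exists (fun t => - f' t); split; [|auto].
  intro t; exact (is_derive_opp f t (f' t) (Hf t)).
Qed.

Lemma times_differentiable_mult (n : nat) (f g : R -> R) :
  times_differentiable n f -> times_differentiable n g ->
  times_differentiable n (fun t => f t * g t).
Proof.
  revert f g; induction n as [|n IH]; intros f g Hf Hg; [exact I|].
  pose proof (times_differentiable_pred n f Hf) as Pf.
  pose proof (times_differentiable_pred n g Hg) as Pg.
  destruct Hf as [f' [Hf Df]], Hg as [g' [Hg Dg]].
  exists (fun t => f' t * g t + f t * g' t); split.
  - intro t; apply (is_derive_mult f g t (f' t) (g' t) (Hf t) (Hg t)).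
    intros x y; apply Rmult_comm.
  - apply times_differentiable_plus; auto.
Qed.

(** The derivative is written [- f' * (/ f * / f)], so that it involves [/ f] itself,
    to which the induction hypothesis applies. *)
Lemma times_differentiable_inv (n : nat) (f : R -> R) :
  (forall t, f t <> 0) ->
  times_differentiable n f -> times_differentiable n (fun t => / f t).
Proof.
  intros Hf0; induction n as [|n IH]; intros Hf; [exact I|].
  pose proof (IH (times_differentiable_pred n f Hf)) as Pi.
  destruct Hf as [f' [Hf Df]].
  exists (fun t => - f' t * (/ f t * / f t)); split.
  - intro t.
    replace (- f' t * (/ f t * / f t)) with (- f' t / f t ^ 2)
      by (field; apply Hf0).
    exact (is_derive_inv f t (f' t) (Hf t) (Hf0 t)).
  - apply times_differentiable_mult;
      [apply times_differentiable_opp | apply times_differentiable_mult]; assumption.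
Qed.

Lemma is_derive_cos_comp (f : R -> R) (t l : R) :
  is_derive f t l -> is_derive (fun s => cos (f s)) t (l * - sin (f t)).
Proof. intro Hf; exact (is_derive_comp cos f t _ l (is_derive_cos (f t)) Hf). Qed.

Lemma is_derive_sin_comp (f : R -> R) (t l : R) :
  is_derive f t l -> is_derive (fun s => sin (f s)) t (l * cos (f t)).
Proof. intro Hf; exact (is_derive_comp sin f t _ l (is_derive_sin (f t)) Hf). Qed.

(** Cosine and sine are treated together because each is the derivative of the other,
    up to sign. *)
Lemma times_differentiable_cos_sin (n : nat) (f : R -> R) :
  times_differentiable n f ->
  times_differentiable n (fun t => cos (f t)) /\
  times_differentiable n (fun t => sin (f t)).
Proof.
  induction n as [|n IH]; intros Hf; [split; exact I|].
  destruct (IH (times_differentiable_pred n f Hf)) as [Pc Ps].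
  destruct Hf as [f' [Hf Df]]; split.
  - exists (fun t => f' t * - sin (f t)); split.
    + intro t; apply is_derive_cos_comp, Hf.
    + apply times_differentiable_mult; [|apply times_differentiable_opp]; assumption.
  - exists (fun t => f' t * cos (f t)); split.
    + intro t; apply is_derive_sin_comp, Hf.
    + apply times_differentiable_mult; assumption.
Qed.

Lemma smooth_is_derive (f : R -> R) (t : R) :
  smooth f -> is_derive f t (Derive f t).
Proof. intro Hf; apply Derive_correct; exact (Hf 1%nat t). Qed.

Lemma smooth_div (f g : R -> R) :
  smooth f -> smooth g -> (forall t, g t <> 0) -> smooth (fun t => f t / g t).
Proof.
  intros Hf Hg Hg0; apply times_differentiable_smooth; intro n.
  apply times_differentiable_mult; [|apply times_differentiable_inv];
    auto using smooth_times_differentiable.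
Qed.

Lemma curve_deriv_gauss (theta : R -> R) (t : R) :
  smooth theta ->
  curve_deriv (gauss theta) t =
  (Derive theta t * - sin (theta t), Derive theta t * cos (theta t)).
Proof.
  intro Ht; unfold curve_deriv, gauss; simpl; f_equal; apply is_derive_unique.
  - apply is_derive_cos_comp, smooth_is_derive, Ht.
  - apply is_derive_sin_comp, smooth_is_derive, Ht.
Qed.

Lemma regular_point_gauss (theta : R -> R) (t : R) :
  smooth theta -> regular_point (gauss theta) t -> Derive theta t <> 0.
Proof.
  intros Ht Hr H0; apply Hr.
  rewrite curve_deriv_gauss by exact Ht; rewrite H0; f_equal; ring.
Qed.

(** The curve [a nu + b mu] in the orthonormal frame [nu = (cos theta, sin theta)],
    [mu = (- sin theta, cos theta)]. *)
Definition frame_curve (theta a b : R -> R) (t : R) : plane :=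
  (a t * cos (theta t) + - (b t * sin (theta t)),
   a t * sin (theta t) + b t * cos (theta t)).

Lemma smooth_frame_curve (theta a b : R -> R) :
  smooth theta -> smooth a -> smooth b -> smooth_curve (frame_curve theta a b).
Proof.
  intros Ht Ha Hb; split; apply times_differentiable_smooth; intro n; simpl;
    destruct (times_differentiable_cos_sin n theta
                (smooth_times_differentiable theta n Ht)) as [Hc Hs];
    apply times_differentiable_plus; try apply times_differentiable_opp;
    apply times_differentiable_mult; auto using smooth_times_differentiable.
Qed.

(** With [nu' = theta' mu] and [mu' = - theta' nu], the derivative of [a nu + b mu] is
    [(a' - b theta') nu + (b' + a theta') mu]. *)
Lemma curve_deriv_frame_curve (theta a b : R -> R) (t : R) :
  smooth theta -> smooth a -> smooth b ->
  curve_deriv (frame_curve theta a b) t =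
  frame_curve theta (fun s => Derive a s - b s * Derive theta s)
                    (fun s => Derive b s + a s * Derive theta s) t.
Proof.
  intros Ht Ha Hb.
  pose proof (smooth_is_derive a t Ha) as Da.
  pose proof (smooth_is_derive b t Hb) as Db.
  pose proof (is_derive_cos_comp theta t _ (smooth_is_derive theta t Ht)) as Dc.
  pose proof (is_derive_sin_comp theta t _ (smooth_is_derive theta t Ht)) as Ds.
  unfold curve_deriv, frame_curve; simpl; f_equal.
  - apply is_derive_unique; evar_last.
    + apply (is_derive_plus (fun s => a s * cos (theta s))
               (fun s => - (b s * sin (theta s)))).
      * exact (is_derive_mult _ _ t _ _ Da Dc Rmult_comm).
      * apply (is_derive_opp (fun s => b s * sin (theta s))).
        exact (is_derive_mult _ _ t _ _ Db Ds Rmult_comm).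
    + unfold plus, opp, mult; simpl; ring.
  - apply is_derive_unique; evar_last.
    + apply (is_derive_plus (fun s => a s * sin (theta s))
               (fun s => b s * cos (theta s))).
      * exact (is_derive_mult _ _ t _ _ Da Ds Rmult_comm).
      * exact (is_derive_mult _ _ t _ _ Db Dc Rmult_comm).
    + unfold plus, mult; simpl; ring.
Qed.

Lemma dot_frame_curve_gauss (theta a b : R -> R) (t : R) :
  dot (frame_curve theta a b t) (gauss theta t) = a t.
Proof.
  transitivity (a t * dot (gauss theta t) (gauss theta t)).
  - unfold dot, frame_curve, gauss; simpl; ring.
  - rewrite gauss_unit; ring.
Qed.

(** The [nu]-component of the curve is [a], which puts it on the lines, and the
    [nu]-component of its derivative is [a' - b theta'], which vanishes precisely by the
    creator equation. *)
Lemma envelope_of_creator (theta a b : R -> R) :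
  smooth theta -> smooth a -> is_creator theta a b ->
  is_envelope theta a (frame_curve theta a b).
Proof.
  intros Ht Ha [Hb Hab]; split; [apply smooth_frame_curve; assumption|].
  intro t; split.
  - rewrite curve_deriv_frame_curve by assumption.
    rewrite dot_frame_curve_gauss, Hab; ring.
  - exact (dot_frame_curve_gauss theta a b t).
Qed.

Theorem corollary1 (theta a : R -> R)
  (theta_smooth : smooth theta) (a_smooth : smooth a)
  (nu_non_singular : non_singular (gauss theta)) :
  creative theta a /\ exists f : R -> plane, is_envelope theta a f.
Proof.
  assert (Hb : is_creator theta a (fun t => Derive a t / Derive theta t)).
  { assert (H0 : forall t, Derive theta t <> 0)
      by (intro t; apply regular_point_gauss; auto).
    split.
    - apply smooth_div; auto using smooth_derivative.
    - intro t; field; apply H0. }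
  split; [exists (fun t => Derive a t / Derive theta t); exact Hb|].
  eexists; exact (envelope_of_creator theta a _ theta_smooth a_smooth Hb).
Qed.
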